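(* Let $\mathbb F$ be a field of characteristic different from $2$ and $3$ containing the primitive cubic roots $\omega,\omega^2$ of $1$, and let $\mathfrak g$ be a Lie algebra over $\mathbb F$ endowed with an action by automorphisms of the dicyclic group $\mathrm{Dic}_3=\langle\theta,\phi:\theta^4=1=\phi^3,\ \phi\theta\phi=\theta\rangle$. On $\mathfrak g_\omega=\{x\in\mathfrak g:\phi(x)=\omega x\}$ define $$\bar x=\theta^2(x),\qquad x*y=\theta^{-1}([x,y]),\qquad \{x,y,z\}=[[x,\theta(y)],z]$$ (these are well defined operations $\mathfrak g_\omega\to\mathfrak g_\omega$, $\mathfrak g_\omega\times\mathfrak g_\omega\to\mathfrak g_\omega$, $\mathfrak g_\omega\times\mathfrak g_\omega\times\mathfrak g_\omega\to\mathfrak g_\omega$). Then the binary product $x*y$ is anticommutative and the map $x\mapsto\bar x$ is an involutive automorphism (that is, $\bar{\bar x}=x$) of both the binary and the ternary products: $\overline{x*y}=\bar x*\bar y$, $\overline{\{x,y,z\}}=\{\bar x,\bar y,\bar z\}$. Moreover, the following identities hold for all $u,v,w,x,y,z\in\mathfrak g_\omega$: (D1) $\{x,z,y\}-\{y,z,x\}=(\bar x*\bar y)*\bar z$; (D2) $\{u,\bar v,x*y\}+\{v,u,x\}*y+x*\{v,u,y\}=0$; (D3) $\{x,y*z,w\}+\{y,z*x,w\}+\{z,x*y,w\}=0$; (D4) $\{\bar x*\bar y,z,w\}+\{\bar y*\bar z,x,w\}+\{\bar z*\bar x,y,w\}=0$; (D5) $\{u,v,\{x,y,z\}\}=\{\{u,v,x\},y,z\}-\{x,\{v,\bar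 u,y\},z\}+\{x,y,\{u,v,z\}\}$.
   Context: An action of $\mathrm{Dic}_3$ by automorphisms on $\mathfrak g$ is a group homomorphism $\mathrm{Dic}_3\to\mathrm{Aut}(\mathfrak g)$; the images of the generators are again denoted $\theta$ and $\phi$. *)

(* Defs.v *)
From HB Require Import structures.
From mathcomp Require Import all_boot all_order all_algebra all_fingroup.
From mathcomp Require Import ring.

Set Implicit Arguments.
Unset Strict Implicit.
Unset Printing Implicit Defensive.

Import GRing.Theory.
Local Open Scope ring_scope.

(* A Lie algebra of arbitrary, possibly infinite, dimension. *)
HB.mixin Record Lmodule_isLieAlgebra (F : fieldType) g of GRing.Lmodule F g := {
  lie : g -> g -> g;
  lie_linearl : forall y, linear (fun x => lie x y);
  lie_linearr : forall x, linear (lie x);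
  liexx : forall x, lie x x = 0;
  lie_jacobi : forall x y z,
    lie x (lie y z) + lie y (lie z x) + lie z (lie x y) = 0
}.

#[short(type="lieAlgType")]
HB.structure Definition LieAlgebra (F : fieldType) :=
  {g of Lmodule_isLieAlgebra F g & GRing.Lmodule F g}.

Notation "[Lie x , y ]" := (lie x y)
  (at level 0, x, y at level 99, format "[Lie  x ,  y ]") : ring_scope.

Definition lie_automorphism (F : fieldType) (g : lieAlgType F) (f : g -> g) :=
  [/\ linear f, {morph f : x y / [Lie x, y]} & bijective f].

(* A group homomorphism G -> Aut(g); products go to composites of maps, so
   elements of G act on the left. *)
Record lieAction (G : groupType) (F : fieldType) (g : lieAlgType F) := LieAction {
  lie_act :> G -> g -> g;
  lie_act_aut : forall a, lie_automorphism (lie_act a);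
  lie_act1 : lie_act 1%g =1 id;
  lie_actM : forall a b, lie_act (a * b)%g =1 lie_act a \o lie_act b
}.

(* [Dic3 i j] is the element theta^i phi^j; since phi theta = theta phi^-1,
   (theta^i phi^j)(theta^k phi^l) = theta^(i+k) phi^((-1)^k j + l). *)
Variant dic3 := Dic3 of 'Z_4 & 'Z_3.

Definition dic3_pair (u : dic3) := let: Dic3 i j := u in (i, j).
Definition dic3_of_pair (v : 'Z_4 * 'Z_3) := Dic3 v.1 v.2.

Lemma dic3_pairK : cancel dic3_pair dic3_of_pair. Proof. by case. Qed.

HB.instance Definition _ := Finite.copy dic3 (can_type dic3_pairK).

Definition dic3_mul (u v : dic3) : dic3 :=
  let: Dic3 i j := u in let: Dic3 k l := v in
  Dic3 (i + k) ((-1) ^+ k * j + l).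
Definition dic3_inv (u : dic3) : dic3 :=
  let: Dic3 i j := u in Dic3 (- i) (- ((-1) ^+ i * j)).

Lemma dic3_signD (i k : 'Z_4) :
  (-1) ^+ (i + k)%R = (-1) ^+ i * (-1) ^+ k :> 'Z_3.
Proof. by apply/eqP; move: i k; do 2!case=> [[|[|[|[|//]]]] ?]. Qed.

Lemma dic3_mulA : associative dic3_mul.
Proof.
by move=> [i j] [k l] [m n] /=; rewrite dic3_signD addrA; congr Dic3; ring.
Qed.

Lemma dic3_mul1 : left_id (Dic3 0 0) dic3_mul.
Proof. by move=> [i j] /=; rewrite mulr0 !add0r. Qed.

Lemma dic3_mulr1 : right_id (Dic3 0 0) dic3_mul.
Proof. by move=> [i j] /=; rewrite expr0 mul1r !addr0. Qed.

Lemma dic3_mulV : left_inverse (Dic3 0 0) dic3_inv dic3_mul.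
Proof.
move=> [i j] /=; rewrite addNr mulrN mulrA -expr2 sqrr_sign mul1r addNr.
by [].
Qed.

Lemma dic3_mulrV : right_inverse (Dic3 0 0) dic3_inv dic3_mul.
Proof.
move=> [i j] /=; rewrite subrr; congr Dic3.
have ->: (-1) ^+ (- i)%R = (-1) ^+ i :> 'Z_3.
  by apply/eqP; move: i; case=> [[|[|[|[|//]]]] ?].
by rewrite subrr.
Qed.

HB.instance Definition _ := isGroup.Build dic3
  dic3_mulA dic3_mul1 dic3_mulr1 dic3_mulV dic3_mulrV.

Definition dic3_theta : dic3 := Dic3 1 0.
Definition dic3_phi : dic3 := Dic3 0 1.

Lemma dic3_rel : [/\ dic3_theta ^+ 4 = 1, dic3_phi ^+ 3 = 1
  & dic3_phi * dic3_theta * dic3_phi = dic3_theta]%g.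
Proof. by split; apply/eqP. Qed.

Lemma dic3E (i : 'Z_4) (j : 'Z_3) :
  (Dic3 i j = dic3_theta ^+ i * dic3_phi ^+ j)%g.
Proof.
by apply/eqP; move: i j; case=> [[|[|[|[|//]]]] ?]; case=> [[|[|[|//]]] ?].
Qed.

(* [dic3] is the group presented by the three relations. *)
Lemma dic3_presentation (H : groupType) (a b : H) :
    (a ^+ 4 = 1)%g -> (b ^+ 3 = 1)%g -> (b * a * b = a)%g ->
  let extends (f : dic3 -> H) :=
    [/\ {morph f : u v / (u * v)%g}, f dic3_theta = a & f dic3_phi = b] in
  exists2 f, extends f & forall f', extends f' -> f' =1 f.
Proof.
move=> a4 b3 bab extends; have xmod x m n : (x ^+ m = 1 :> H)%g ->
    (x ^+ (n %% m) = x ^+ n)%g.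
  by move=> xm; rewrite [in RHS](divn_eq n m) expgnDr mulnC expgnA xm expg1n mul1g.
have ba n : (b ^+ n * a = a * (b^-1) ^+ n)%g.
  elim: n => [|n IHn]; first by rewrite !expg0 mulg1 mul1g.
  rewrite expgSr -mulgA [X in (_ * X)%g](_ : _ = a * b^-1)%g; last first.
    by rewrite -[in RHS]bab -!mulgA mulgV mulg1.
  by rewrite mulgA IHn -mulgA -expgSr.
have bV : (b^-1 = b ^+ 2)%g.
  by apply: (mulgI b); rewrite mulgV -expgS b3.
exists (fun u => let: Dic3 i j := u in (a ^+ i * b ^+ j)%g).
  split; last 2 first.
  - by rewrite /= expg1 mulg1.
  - by rewrite /= expg1 mul1g.
  have bak (j k : nat) : (b ^+ j * a ^+ k = a ^+ k * b ^+ (2 ^ k * j))%g.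
    elim: k => [|k IHk] in j *; first by rewrite expg0 mulg1 mul1g mul1n.
    rewrite expgS mulgA ba bV -expgnA -mulgA IHk mulgA; congr (_ * b ^+ _)%g.
    by rewrite expnSr mulnA.
  move=> [i j] [k l] /=; rewrite -!mulgA [X in _ = (_ * X)%g]mulgA bak.
  rewrite -mulgA -expgnDr mulgA -expgnDr (xmod a 4) //; congr (_ * _)%g.
  rewrite -[RHS](xmod b 3) //; congr (b ^+ _)%g.
  by move: j k l => [[|[|[|//]]] ?] [[|[|[|[|//]]]] ?] [[|[|[|//]]] ?].
move=> f' [f'M f'a f'b] [i j]; rewrite dic3E f'M.
have f'1 : (f' 1 = 1)%g by apply: (mulgI (f' 1%g)); rewrite -f'M !mulg1.
have f'X u n : (f' (u ^+ n) = f' u ^+ n)%g.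
  by elim: n => [|n IHn]; rewrite ?expg0 // !expgS f'M IHn.
by rewrite !f'X f'a f'b.
Qed.

Section Operations.

Variables (F : fieldType) (g : lieAlgType F) (rho : lieAction dic3 g) (omega : F).

Definition dic3_eigen : {pred g} := [pred x | rho dic3_phi x == omega *: x].

Definition dic3_bar (x : g) : g := rho (dic3_theta ^+ 2)%g x.

Definition dic3_star (x y : g) : g := rho (dic3_theta^-1)%g [Lie x, y].

Definition dic3_triple (x y z : g) : g := [Lie [Lie x, rho dic3_theta y], z].

End Operations.

(* Main.v *)
Require Import Defs.
From HB Require Import structures.
From mathcomp Require Import all_boot all_order all_algebra all_fingroup.

Set Implicit Arguments.
Unset Strict Implicit.
Unset Printing Implicit Defensive.

Import GRing.Theory.
Local Open Scope ring_scope.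

(** Write [t] for the automorphism given by theta, so that bar is [t^2], and
[x * y = t^-1 [x, y]], [{x, y, z} = [[x, t y], z]]. The eigenspaces of phi
grade the Lie algebra multiplicatively, and [t] exchanges the eigenvalues [a]
and [a^-1] because phi theta phi = theta. As [omega^2 = omega^-1], the bracket
of two elements of the [omega]-eigenspace has eigenvalue [omega^-1], which
[t^-1] brings back to [omega], and [[x, t y]] has eigenvalue 1, so that it
stabilises every eigenspace: the operations are well defined.

Pushing every power of [t] inwards and using [t^4 = 1] turns each identity into
a form of the Jacobi identity. For [triple_swap] it is the Jacobi identity of
[x], [y] and [t z], since [(bar x * bar y) * bar z = [[x, y], t z]]. In
[triple_star_jacobi] and [star_triple_jacobi] it is the cyclic Jacobi identity
bracketed with [w]. The two derivation rules, [triple_star_derivation] and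
[triple_triple], say that the inner derivation of [[v, t u]] acts on [[x, y]],
and that of [[u, t v]] on [[[x, t y], z]], by the Leibniz rule. *)

Section LieTheory.

Variables (F : fieldType) (g : lieAlgType F).
Implicit Types x y z : g.

Lemma lieDl x y z : [Lie x + y, z] = [Lie x, z] + [Lie y, z].
Proof. by have := lie_linearl z 1 x y; rewrite !scale1r. Qed.

Lemma lieDr x y z : [Lie x, y + z] = [Lie x, y] + [Lie x, z].
Proof. by have := lie_linearr x 1 y z; rewrite !scale1r. Qed.

Lemma lie0l x : [Lie 0, x] = 0.
Proof. by apply: (addrI [Lie 0, x]); rewrite -lieDl !addr0. Qed.

Lemma lie0r x : [Lie x, 0] = 0.
Proof. by apply: (addrI [Lie x, 0]); rewrite -lieDr !addr0. Qed.

Lemma lieZl a x y : [Lie a *: x, y] = a *: [Lie x, y].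
Proof. by have := lie_linearl y a x 0; rewrite !addr0 lie0l addr0. Qed.

Lemma lieZr a x y : [Lie x, a *: y] = a *: [Lie x, y].
Proof. by have := lie_linearr x a y 0; rewrite !addr0 lie0r addr0. Qed.

Lemma lieC x y : [Lie x, y] = - [Lie y, x].
Proof.
by apply/eqP; rewrite -addr_eq0 -(liexx (x + y)) lieDl !lieDr !liexx add0r addr0.
Qed.

Lemma lieNl x y : [Lie - x, y] = - [Lie x, y].
Proof. by rewrite -scaleN1r lieZl scaleN1r. Qed.

Lemma lieNr x y : [Lie x, - y] = - [Lie x, y].
Proof. by rewrite -scaleN1r lieZr scaleN1r. Qed.

Lemma lie_jacobil x y z :
  [Lie [Lie x, y], z] + [Lie [Lie y, z], x] + [Lie [Lie z, x], y] = 0.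
Proof.
rewrite (lieC [Lie x, y]) (lieC [Lie y, z]) (lieC [Lie z, x]) -!opprD.
by rewrite lie_jacobi oppr0.
Qed.

Lemma lie_derivation d x y :
  [Lie d, [Lie x, y]] = [Lie [Lie d, x], y] + [Lie x, [Lie d, y]].
Proof.
rewrite (lieC [Lie d, x]) (lieC d y) lieNr -opprD [X in - X]addrC.
by apply/eqP; rewrite -addr_eq0 addrA lie_jacobi.
Qed.

End LieTheory.

Section LieActionTheory.

Variables (G : groupType) (F : fieldType) (g : lieAlgType F).
Variable rho : lieAction G g.
Implicit Types (a b : G) (x y : g).

Lemma lie_act_linear a : linear (rho a).
Proof. by have [] := lie_act_aut rho a. Qed.

Lemma lie_actD a x y : rho a (x + y) = rho a x + rho a y.
Proof. by have := lie_act_linear a 1 x y; rewrite !scale1r. Qed.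

Lemma lie_act0 a : rho a 0 = 0.
Proof. by apply: (addrI (rho a 0)); rewrite -lie_actD !addr0. Qed.

Lemma lie_actZ a c x : rho a (c *: x) = c *: rho a x.
Proof. by have := lie_act_linear a c x 0; rewrite !addr0 lie_act0 addr0. Qed.

Lemma lie_actN a x : rho a (- x) = - rho a x.
Proof. by rewrite -scaleN1r lie_actZ scaleN1r. Qed.

Lemma lie_act_lie a x y : rho a [Lie x, y] = [Lie rho a x, rho a y].
Proof. by have [_ act_lie _] := lie_act_aut rho a; apply: act_lie. Qed.

Lemma lie_actMr a b x : rho a (rho b x) = rho (a * b)%g x.
Proof. by rewrite lie_actM. Qed.

End LieActionTheory.

Section Dic3Action.

Variables (F : fieldType) (g : lieAlgType F) (rho : lieAction dic3 g).
Implicit Types (a b : F) (u v w x y z : g).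

Local Notation t := dic3_theta.
Local Notation phi := dic3_phi.
Local Notation eigen := (dic3_eigen rho).
Local Notation bar := (dic3_bar rho).
Local Notation star := (dic3_star rho).
Local Notation tri := (dic3_triple rho).

Lemma eigen_lie a b x y :
  x \in eigen a -> y \in eigen b -> [Lie x, y] \in eigen (a * b).
Proof.
move=> /eqP xa /eqP yb; apply/eqP.
by rewrite lie_act_lie xa yb lieZl lieZr scalerA.
Qed.

(** The relation satisfied by [s] reads [phi (s (phi x)) = s x], and its
left-hand side is [a *: phi (s x)]. It holds for both theta and its inverse. *)
Lemma eigen_inv (s : dic3) a x : (phi * s * phi = s)%g -> a != 0 ->
  x \in eigen a -> rho s x \in eigen a^-1.
Proof.
move=> sE a0 /eqP xa; apply/eqP.
rewrite -[in RHS]sE -!lie_actMr xa !lie_actZ scalerA mulVf //.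
by rewrite scale1r.
Qed.

Lemma eigen_theta a x : a != 0 -> x \in eigen a -> rho t x \in eigen a^-1.
Proof. by apply: eigen_inv; apply/eqP. Qed.

Lemma eigen_thetaV a x :
  a != 0 -> x \in eigen a -> rho t^-1%g x \in eigen a^-1.
Proof. by apply: eigen_inv; apply/eqP. Qed.

Lemma eigen_bar a x : a != 0 -> x \in eigen a -> bar x \in eigen a.
Proof.
move=> a0 xa; rewrite /dic3_bar expgS expg1 lie_actM -[a]invrK.
by apply: eigen_theta; rewrite ?invr_eq0 //; apply: eigen_theta.
Qed.

(** The bracket has eigenvalue [a^2 = a^-1], which the inverse of theta turns
into [a]: this is where a cube root of unity is needed. *)
Lemma eigen_star a x y :
  a ^+ 3 = 1 -> x \in eigen a -> y \in eigen a -> star x y \in eigen a.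
Proof.
move=> a3 xa ya; have a0: a != 0 by rewrite -unitfE -(@unitrX_pos _ a 3) ?a3 ?unitr1.
have aV: (a * a)^-1 = a by rewrite -[RHS]mul1r -(mulVf (mulf_neq0 a0 a0))
  -mulrA -expr2 -exprSr a3 mulr1.
by rewrite -[X in eigen X]aV eigen_thetaV ?mulf_neq0 ?eigen_lie.
Qed.

Lemma eigen_triple a b x y z : a != 0 ->
  x \in eigen a -> y \in eigen a -> z \in eigen b -> tri x y z \in eigen b.
Proof.
move=> a0 xa ya zb; rewrite -[b]mul1r -(mulfV a0).
by apply: eigen_lie => //; apply: eigen_lie => //; apply: eigen_theta.
Qed.

Lemma star_anticomm x y : star x y = - star y x.
Proof. by rewrite /dic3_star lieC lie_actN. Qed.

Lemma theta_thetaV x : rho t (rho t^-1%g x) = x.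
Proof. by rewrite lie_actMr mulgV lie_act1. Qed.

Lemma thetaV_theta x : rho t^-1%g (rho t x) = x.
Proof. by rewrite lie_actMr mulVg lie_act1. Qed.

Lemma barK : involutive bar.
Proof.
move=> x; rewrite /dic3_bar lie_actMr (_ : _ * _ = 1)%g ?lie_act1 //.
by apply/eqP.
Qed.

Lemma theta_bar x : rho t (bar x) = rho t^-1%g x.
Proof. by rewrite /dic3_bar lie_actMr; congr (rho _ x); apply/eqP. Qed.

Lemma thetaV_bar x : rho t^-1%g (bar x) = rho t x.
Proof. by rewrite -theta_bar barK. Qed.

Lemma bar_theta x : bar (rho t x) = rho t (bar x).
Proof. by rewrite /dic3_bar !lie_actMr; congr (rho _ x); apply/eqP. Qed.

Lemma bar_thetaV x : bar (rho t^-1%g x) = rho t^-1%g (bar x).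
Proof. by rewrite -theta_bar bar_theta theta_bar. Qed.

Lemma bar_lie x y : bar [Lie x, y] = [Lie bar x, bar y].
Proof. exact: lie_act_lie. Qed.

Lemma bar_star x y : bar (star x y) = star (bar x) (bar y).
Proof. by rewrite /dic3_star bar_thetaV bar_lie. Qed.

Lemma bar_triple x y z : bar (tri x y z) = tri (bar x) (bar y) (bar z).
Proof. by rewrite /dic3_triple !bar_lie bar_theta. Qed.

Lemma star_bar x y : star (bar x) (bar y) = rho t [Lie x, y].
Proof. by rewrite /dic3_star -bar_lie thetaV_bar. Qed.

Lemma triple_swap x y z :
  tri x z y - tri y z x = star (star (bar x) (bar y)) (bar z).
Proof.
rewrite [in RHS]star_bar [in RHS]/dic3_star lie_act_lie thetaV_theta thetaV_bar.
rewrite /dic3_triple (lieC y (rho t z)) (lieC x y) !lieNl opprK.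
by apply/eqP; rewrite -addr_eq0 lie_jacobil.
Qed.

(** Applying the inverse of theta to the derivation rule for [[v, t u]] acting
on [[x, y]]. *)
Lemma triple_star_derivation u v x y :
  tri u (bar v) (star x y) + star (tri v u x) y + star x (tri v u y) = 0.
Proof.
have -> : tri u (bar v) (star x y) =
    - rho t^-1%g [Lie [Lie v, rho t u], [Lie x, y]].
  rewrite /dic3_triple /dic3_star theta_bar -{1}(thetaV_theta u) -!lie_act_lie.
  by rewrite (lieC (rho t u)) lieNl lie_actN.
by rewrite -addrA /dic3_star -lie_actD -lie_derivation addNr.
Qed.

Lemma triple_star_jacobi x y z w :
  tri x (star y z) w + tri y (star z x) w + tri z (star x y) w = 0.
Proof.
by rewrite /dic3_triple /dic3_star !theta_thetaV -!lieDl lie_jacobi lie0l.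
Qed.

Lemma star_triple_jacobi x y z w :
  tri (star (bar x) (bar y)) z w + tri (star (bar y) (bar z)) x w
    + tri (star (bar z) (bar x)) y w = 0.
Proof.
rewrite !star_bar /dic3_triple -!lie_act_lie -!lieDl -!lie_actD.
by rewrite lie_jacobil lie_act0 lie0l.
Qed.

(** On the middle argument, which enters the triple product through theta, the
derivation [[u, t v]] acts as its conjugate [[t^-1 u, v]] by theta; this is
minus [[v, t (bar u)]], whence the sign in the middle term. *)
Lemma triple_triple u v x y z :
  tri u v (tri x y z)
    = tri (tri u v x) y z - tri x (tri v (bar u) y) z + tri x y (tri u v z).
Proof.
have dy : [Lie [Lie u, rho t v], rho t y] = - rho t (tri v (bar u) y).
  rewrite /dic3_triple theta_bar !lie_act_lie theta_thetaV -lieNl.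
  by congr [Lie _, _]; exact: lieC.
rewrite [LHS]lie_derivation [X in [Lie X, z] + _]lie_derivation dy.
by rewrite lieDl lieNr lieNl.
Qed.

End Dic3Action.

Theorem theorem5p1 (F : fieldType) (char_not2 : 2%N \notin [pchar F])
    (char_not3 : 3%N \notin [pchar F]) (omega : F)
    (omega_prim : 3.-primitive_root omega)
    (g : lieAlgType F) (rho : lieAction dic3 g) :
  let gw := dic3_eigen rho omega in
  let bar := dic3_bar rho in
  let star := dic3_star rho in
  let tri := dic3_triple rho in
  (* well-definedness *)
  [/\ {in gw, forall x, bar x \in gw},
      {in gw &, forall x y, star x y \in gw}
    & {in gw & &, forall x y z, tri x y z \in gw}] /\
  (* anticommutativity *)
  {in gw &, forall x y, star x y = - star y x} /\
  (* the bar map is an involutive automorphism *)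
  [/\ forall a, {in gw &, forall x y, bar (a *: x + y) = a *: bar x + bar y},
      {in gw, forall x, bar (bar x) = x},
      {in gw &, forall x y, bar (star x y) = star (bar x) (bar y)}
    & {in gw & &, forall x y z,
         bar (tri x y z) = tri (bar x) (bar y) (bar z)}] /\
  (* (D1)-(D5) *)
  (forall u v w x y z : g,
     u \in gw -> v \in gw -> w \in gw -> x \in gw -> y \in gw -> z \in gw ->
     [/\ tri x z y - tri y z x = star (star (bar x) (bar y)) (bar z),
         tri u (bar v) (star x y) + star (tri v u x) y + star x (tri v u y) = 0,
         tri x (star y z) w + tri y (star z x) w + tri z (star x y) w = 0,
         tri (star (bar x) (bar y)) z w + tri (star (bar y) (bar z)) x w
           + tri (star (bar z) (bar x)) y w = 0
       & tri u v (tri x y z)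
           = tri (tri u v x) y z - tri x (tri v (bar u) y) z
             + tri x y (tri u v z)]).
Proof.
move=> gw bar star tri.
have w3 : omega ^+ 3 = 1 := prim_expr_order omega_prim.
have w0 : omega != 0 by rewrite -unitfE -(@unitrX_pos _ omega 3) ?w3 ?unitr1.
split; first split.
- by move=> x; apply: eigen_bar.
- by move=> x y; apply: eigen_star.
- by move=> x y z; apply: eigen_triple.
split; first by move=> x y _ _; apply: star_anticomm.
split; first split.
- by move=> a x y _ _; apply: lie_act_linear.
- by move=> x _; apply: barK.
- by move=> x y _ _; apply: bar_star.
- by move=> x y z _ _ _; apply: bar_triple.
move=> u v w x y z _ _ _ _ _ _; split.
- exact: triple_swap.
- exact: triple_star_derivation.
- exact: triple_star_jacobi.
- exact: star_triple_jacobi.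
- exact: triple_triple.
Qed.
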